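(* Let $H$ be a connected graph with $H\prec S_{12}$. Then either $H\simeq S_{10}$ or $H\simeq S_{12}$.
   Context: Graphs are finite, undirected and loopless, but may contain parallel edges; $\simeq$ denotes isomorphism of (multi)graphs. For a vertex $u$ of a graph $G$, $\partial_G u$ denotes the set of edges of $G$ incident to $u$. An $H$-colouring of $G$ is a map $f:E(G)\to E(H)$ that is a proper edge-colouring (adjacent edges of $G$ receive distinct edges of $H$) such that for every $u\in V(G)$ there exists $v\in V(H)$ with $f(\partial_G u)=\partial_H v$. We write $H\prec G$ ($H$ colours $G$) if $G$ admits an $H$-colouring. $S_{10}$ (the Sylvester graph) is the cubic multigraph on the ten vertices $z$ and $u^i,v^i,w^i$ ($i\in\{1,2,3\}$) whose edges are, for each $i\in\{1,2,3\}$: two parallel edges between $v^i$ and $w^i$, one edge $u^iv^i$, one edge $u^iw^i$, and one edge $u^iz$. $S_{12}$ is the cubic multigraph on the twelve vertices $z^i,u^i,v^i,w^i$ ($i\in\{1,2,3\}$) whose edges are: for each $i\in\{1,2,3\}$, two parallel edges between $v^i$ and $w^i$, one edge $u^iv^i$, one edge $u^iw^i$, one edge $u^iz^i$; together with the three edges $z^1z^2$, $z^2z^3$, $z^1z^3$. *)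

(* Defs.v *)
From HB Require Import structures.
From mathcomp Require Import all_boot.

Set Implicit Arguments.
Unset Strict Implicit.
Unset Printing Implicit Defensive.

(* Since [ends e] is a set with exactly two elements, edges are undirected and
   loopless; distinct edges may have the same ends (parallel edges). *)
Record multigraph := Multigraph {
  vertex : finType;
  edge : finType;
  ends : edge -> {set vertex};
  card_ends : forall e, #|ends e| = 2
}.

Definition incident_edges (G : multigraph) (u : vertex G) : {set edge G} :=
  [set e | u \in ends e].
Arguments incident_edges : clear implicits.

Definition adjacent_edges (G : multigraph) : rel (edge G) :=
  fun e e' => (e != e') && (ends e :&: ends e' != set0).
Arguments adjacent_edges : clear implicits.

Definition adjacent_vertices (G : multigraph) : rel (vertex G) :=
  fun u v => [exists e : edge G, ends e == [set u; v]].
Arguments adjacent_vertices : clear implicits.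

(* The graph without vertices is not considered connected. *)
Definition connected (G : multigraph) : Prop :=
  0 < #|vertex G| /\ forall u v : vertex G, connect (adjacent_vertices G) u v.

Definition isomorphic (G H : multigraph) : Prop :=
  exists (fV : vertex G -> vertex H) (fE : edge G -> edge H),
    [/\ bijective fV, bijective fE &
        forall e : edge G, ends (fE e) = fV @: ends e].

Definition is_colouring (H G : multigraph) (f : edge G -> edge H) : Prop :=
  (forall e e' : edge G, adjacent_edges G e e' -> f e <> f e') /\
  (forall u : vertex G, exists v : vertex H,
     f @: incident_edges G u = incident_edges H v).
Arguments is_colouring : clear implicits.

(* [colours H G] is H ≺ G: it is H that colours G. *)
Definition colours (H G : multigraph) : Prop :=
  exists f : edge G -> edge H, is_colouring H G f.

Inductive S10_vertex := z10 | u10 of 'I_3 | v10 of 'I_3 | w10 of 'I_3.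

Definition S10_vertex_code (x : S10_vertex) : option ('I_3 + 'I_3 + 'I_3) :=
  match x with
  | z10 => None
  | u10 i => Some (inl (inl i))
  | v10 i => Some (inl (inr i))
  | w10 i => Some (inr i)
  end.

Definition S10_vertex_decode (c : option ('I_3 + 'I_3 + 'I_3)) : S10_vertex :=
  match c with
  | None => z10
  | Some (inl (inl i)) => u10 i
  | Some (inl (inr i)) => v10 i
  | Some (inr i) => w10 i
  end.

Lemma S10_vertex_codeK : cancel S10_vertex_code S10_vertex_decode.
Proof. by case. Qed.

HB.instance Definition _ := Finite.copy S10_vertex (can_type S10_vertex_codeK).

(* The Boolean distinguishes the two parallel edges between v^i and w^i. *)
Inductive S10_edge :=
  | vw10 of 'I_3 & bool | uv10 of 'I_3 | uw10 of 'I_3 | uz10 of 'I_3.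

Definition S10_edge_code (e : S10_edge) : 'I_3 * bool + 'I_3 + 'I_3 + 'I_3 :=
  match e with
  | vw10 i b => inl (inl (inl (i, b)))
  | uv10 i => inl (inl (inr i))
  | uw10 i => inl (inr i)
  | uz10 i => inr i
  end.

Definition S10_edge_decode (c : 'I_3 * bool + 'I_3 + 'I_3 + 'I_3) : S10_edge :=
  match c with
  | inl (inl (inl (i, b))) => vw10 i b
  | inl (inl (inr i)) => uv10 i
  | inl (inr i) => uw10 i
  | inr i => uz10 i
  end.

Lemma S10_edge_codeK : cancel S10_edge_code S10_edge_decode.
Proof. by case. Qed.

HB.instance Definition _ := Finite.copy S10_edge (can_type S10_edge_codeK).

Definition S10_ends (e : S10_edge) : {set S10_vertex} :=
  match e with
  | vw10 i _ => [set v10 i; w10 i]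
  | uv10 i => [set u10 i; v10 i]
  | uw10 i => [set u10 i; w10 i]
  | uz10 i => [set u10 i; z10]
  end.

Lemma S10_card_ends (e : S10_edge) : #|S10_ends e| = 2.
Proof. by case: e => *; rewrite cards2. Qed.

Definition S10 : multigraph := Multigraph S10_card_ends.

Inductive S12_vertex :=
  z12 of 'I_3 | u12 of 'I_3 | v12 of 'I_3 | w12 of 'I_3.

Definition S12_vertex_code (x : S12_vertex) : 'I_3 + 'I_3 + 'I_3 + 'I_3 :=
  match x with
  | z12 i => inl (inl (inl i))
  | u12 i => inl (inl (inr i))
  | v12 i => inl (inr i)
  | w12 i => inr i
  end.

Definition S12_vertex_decode (c : 'I_3 + 'I_3 + 'I_3 + 'I_3) : S12_vertex :=
  match c with
  | inl (inl (inl i)) => z12 i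
  | inl (inl (inr i)) => u12 i
  | inl (inr i) => v12 i
  | inr i => w12 i
  end.

Lemma S12_vertex_codeK : cancel S12_vertex_code S12_vertex_decode.
Proof. by case. Qed.

HB.instance Definition _ := Finite.copy S12_vertex (can_type S12_vertex_codeK).

Inductive S12_edge :=
  | vw12 of 'I_3 & bool | uv12 of 'I_3 | uw12 of 'I_3 | uz12 of 'I_3
  | zz12 of 'I_3.

Definition S12_edge_code (e : S12_edge) :
    'I_3 * bool + 'I_3 + 'I_3 + 'I_3 + 'I_3 :=
  match e with
  | vw12 i b => inl (inl (inl (inl (i, b))))
  | uv12 i => inl (inl (inl (inr i)))
  | uw12 i => inl (inl (inr i))
  | uz12 i => inl (inr i)
  | zz12 i => inr i
  end.

Definition S12_edge_decode (c : 'I_3 * bool + 'I_3 + 'I_3 + 'I_3 + 'I_3) :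
    S12_edge :=
  match c with
  | inl (inl (inl (inl (i, b)))) => vw12 i b
  | inl (inl (inl (inr i))) => uv12 i
  | inl (inl (inr i)) => uw12 i
  | inl (inr i) => uz12 i
  | inr i => zz12 i
  end.

Lemma S12_edge_codeK : cancel S12_edge_code S12_edge_decode.
Proof. by case. Qed.

HB.instance Definition _ := Finite.copy S12_edge (can_type S12_edge_codeK).

(* [ordS] is the cyclic successor on 'I_3, so that the edges [zz12 i] form the
   triangle on the three vertices z^i. *)
Definition S12_ends (e : S12_edge) : {set S12_vertex} :=
  match e with
  | vw12 i _ => [set v12 i; w12 i]
  | uv12 i => [set u12 i; v12 i]
  | uw12 i => [set u12 i; w12 i]
  | uz12 i => [set u12 i; z12 i]
  | zz12 i => [set z12 i; z12 (ordS i)]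
  end.

Lemma S12_card_ends (e : S12_edge) : #|S12_ends e| = 2.
Proof.
by case: e => [? ?|?|?|?|[[|[|[|?]]] ?]] //; rewrite cards2.
Qed.

Definition S12 : multigraph := Multigraph S12_card_ends.

(* Main.v *)
(* Each pendant part of S12 must be mapped isomorphically into H: the edges of
   its two outer vertices force a multiedge, which the inner vertex does not
   meet.  The three vertices of the central triangle are then sent either to
   three distinct vertices, which makes the map on vertices injective, or to a
   single vertex p.  In the second case each triangle edge has the same image
   as the bridge at the opposite vertex, so the colouring factors through the
   contraction of the triangle, which is S10.  An injective map on vertices
   preserves degrees, so by connectedness of H it is an isomorphism. *)
Require Import Defs.
From mathcomp Require Import all_boot.

Set Implicit Arguments.
Unset Strict Implicit.
Unset Printing Implicit Defensive.

(** * Isomorphisms from injective vertex maps *)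

Lemma ends_eq2 (G : multigraph) (g : edge G) (x y : vertex G) :
  x \in ends g -> y \in ends g -> x != y -> ends g = [set x; y].
Proof.
move=> xg yg xy; apply/esym/eqP.
by rewrite eqEcard subUset !sub1set xg yg cards2 card_ends xy.
Qed.

(** Since [X] carries stars to stars, the ends of [f e] are the images of the ends of [e], and every
    edge at some [X u] is an [f e]. Hence the other end of such an edge is again some [X u'];
    following paths from [X u0] makes [X], then [f], surjective. The last hypothesis separates
    parallel edges, which [X] cannot tell apart. *)
Lemma isomorphic_of_injective (H G : multigraph) (f : edge G -> edge H)
    (X : vertex G -> vertex H) :
  connected H -> 0 < #|vertex G| -> injective X ->
  (forall u, f @: incident_edges G u = incident_edges H (X u)) ->
  (forall e e', ends e = ends e' -> f e = f e' -> e = e') ->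
  isomorphic H G.
Proof.
move=> [_ connH] /card_gt0P[u0 _] injX starX parf.
have endsf e : ends (f e) = X @: ends e.
  apply/esym/eqP; rewrite eqEcard card_imset // !card_ends leqnn andbT.
  apply/subsetP => _ /imsetP[u ue ->].
  have : f e \in incident_edges H (X u) by rewrite -starX imset_f // inE.
  by rewrite inE.
have injf : injective f.
  move=> e e' fee; apply: parf => //; apply: (imset_inj injX).
  by rewrite -!endsf fee.
have surjE g u : X u \in ends g -> exists e, g = f e.
  move=> ug; have : g \in incident_edges H (X u) by rewrite inE.
  by rewrite -starX => /imsetP[e _ ->]; exists e.
have surjX y : exists u, y = X u.
  have /connectP[p pth ->] := connH (X u0) y.
  elim: p u0 pth => [|y' p IHp] u /=; first by exists u.
  case/andP=> /existsP[g /eqP gE].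
  have [|e gfe] := surjE g u; first by rewrite gE set21.
  have : y' \in ends g by rewrite gE set22.
  by rewrite gfe endsf => /imsetP[u' _ ->]; apply: IHp.
have surjf g : exists e, g = f e.
  have : 0 < #|ends g| by rewrite card_ends.
  by case/card_gt0P=> y; have [u ->] := surjX y; apply: surjE.
have [X' X'K] := fin_all_exists surjX; have [f' f'K] := fin_all_exists surjf.
exists X', f'; split.
- by exists X => [y|u]; [rewrite -X'K | apply: injX; rewrite -X'K].
- by exists f => [g|e]; [rewrite -f'K | apply: injf; rewrite -f'K].
move=> g; rewrite [in RHS](f'K g) endsf -imset_comp -[LHS]imset_id.
by apply: eq_imset => u /=; apply: injX; rewrite -X'K.
Qed.

(** * Pendant parts and how two of them can overlap *)

Definition on_multiedge (H : multigraph) (x : vertex H) : Prop :=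
  exists g h : edge H, [/\ g != h, x \in ends g & ends g = ends h].

(* The image of one of the three pendant parts of S12: [u], [v], [w] span a
   triangle with edges [a], [c], [d], the edge [b] is parallel to [a], and [e]
   is the edge leaving the part. *)
Record block (H : multigraph) (u v w : vertex H) (a b c d e : edge H) : Prop :=
  Block {
    block_u : forall g, (u \in ends g) = [|| g == c, g == d | g == e];
    block_v : forall g, (v \in ends g) = [|| g == a, g == b | g == c];
    block_w : forall g, (w \in ends g) = [|| g == a, g == b | g == d];
    block_uniq : uniq [:: a; b; c; d];
    block_uniq_u : uniq [:: c; d; e]
  }.

Section Block.
Context (H : multigraph).
Implicit Types (u v w : vertex H) (a b c d e g : edge H).

Lemma block_swap u v w a b c d e :
  block u v w a b c d e -> block u w v a b d c e.
Proof.
case=> bu bv bw uq uqu; split=> //.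
- by move=> g; rewrite bu orbCA.
- by move: uq; rewrite /= !inE [d == c]eq_sym; do 6 case: (_ == _).
- by move: uqu; rewrite /= !inE [d == c]eq_sym; do 3 case: (_ == _).
Qed.

Lemma block_neq u v w a b c d e :
  block u v w a b c d e -> [/\ u != v, u != w & v != w].
Proof.
case=> bu bv bw /=; rewrite !inE !negb_or.
move=> /and4P[/and3P[ab ac ad] /andP[bc bd] cd _] _.
split; apply/eqP=> E.
- by have := bv d; rewrite -E bu eqxx orbT ![d == _]eq_sym
    (negPf ad) (negPf bd) (negPf cd).
- by have := bw c; rewrite -E bu eqxx ![c == _]eq_sym
    (negPf ac) (negPf bc) [d == c]eq_sym (negPf cd).
- by have := bw c; rewrite -E bv eqxx !orbT ![c == _]eq_sym
    (negPf ac) (negPf bc) [d == c]eq_sym (negPf cd).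
Qed.

Lemma block_ends u v w a b c d e : block u v w a b c d e ->
  [/\ ends a = [set v; w], ends b = [set v; w], ends c = [set u; v]
    & ends d = [set u; w]].
Proof.
move=> B; have [uv uw vw] := block_neq B; case: B => bu bv bw _ _.
by split; apply: ends_eq2; rewrite ?bu ?bv ?bw ?eqxx ?orbT.
Qed.

Lemma block_exit_v u v w a b c d e : block u v w a b c d e -> v \notin ends e.
Proof.
move=> B; have [uv uw vw] := block_neq B; have [Ea Eb _ _] := block_ends B.
case: B => bu bv _ _ /=; rewrite !inE negb_or => /and3P[/andP[_ ce] _ _].
have ue : u \in ends e by rewrite bu eqxx !orbT.
rewrite bv [e == c]eq_sym (negPf ce) orbF.
by apply/norP; split; apply/eqP=> E; move: ue;
  rewrite E ?Ea ?Eb !inE (negPf uv) (negPf uw).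
Qed.

Lemma block_exit_w u v w a b c d e : block u v w a b c d e -> w \notin ends e.
Proof. by move/block_swap; apply: block_exit_v. Qed.

Lemma block_multiedge_v u v w a b c d e :
  block u v w a b c d e -> on_multiedge v.
Proof.
move=> B; have [Ea Eb _ _] := block_ends B; exists a, b.
rewrite Ea Eb set21; split=> //.
by case: B => _ _ _ /=; rewrite !inE; case: eqP.
Qed.

Lemma block_multiedge_w u v w a b c d e :
  block u v w a b c d e -> on_multiedge w.
Proof. by move/block_swap; apply: block_multiedge_v. Qed.

(** No two of the three edges at [u] are parallel: [c] meets [v] but not [w], [d] meets [w] but not
    [v], and [e] meets neither. *)
Lemma block_multiedge_u u v w a b c d e :
  block u v w a b c d e -> ~ on_multiedge u.
Proof.
move=> B [g [h [gh ug Egh]]].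
have uh : u \in ends h by rewrite -Egh.
have [uv uw vw] := block_neq B; have [_ _ Ec Ed] := block_ends B.
have ve := block_exit_v B; have we := block_exit_w B.
have vgh : (v \in ends g) = (v \in ends h) by rewrite Egh.
have wgh : (w \in ends g) = (w \in ends h) by rewrite Egh.
move: ug uh vgh wgh gh; rewrite !(block_u B).
by case/or3P=> /eqP-> /or3P[] /eqP->;
  rewrite ?eqxx // ?Ec ?Ed !inE ?eqxx ?orbT ?(negPf ve) ?(negPf we)
  ?[v == u]eq_sym ?[w == u]eq_sym ?[w == v]eq_sym
  ?(negPf uv) ?(negPf uw) ?(negPf vw).
Qed.

(** An outer vertex determines the inner one: [c] is the only edge at [v] outside the multiedge, and
    [u] is its other end. *)
Lemma block_v_inj u u' v w w' a a' b b' c c' d d' e e' :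
  block u v w a b c d e -> block u' v w' a' b' c' d' e' -> u = u'.
Proof.
move=> B B'.
have [Ea Eb Ec _] := block_ends B; have [Ea' Eb' Ec' _] := block_ends B'.
have [uv uw vw] := block_neq B; have [uv' uw' vw'] := block_neq B'.
have ccE : c' = c.
  have: c' \in incident_edges H v by rewrite inE (block_v B') eqxx !orbT.
  rewrite inE (block_v B) => c'v.
  (* Otherwise [c'] is one of the parallel edges [a], [b], and [u'] meets a
     multiedge. *)
  have nmu := block_multiedge_u B'.
  apply/eqP/negPn/negP=> c'c; apply: nmu.
  move: c'v; rewrite (negPf c'c) orbF => c'ab.
  case: B => _ _ _ /=; rewrite !inE !negb_or => /and4P[/and3P[ab _ _] _ _ _] _.
  have [E|E] := orP c'ab.
    by exists c', b; rewrite (eqP E) Ea Eb -Ea -(eqP E) Ec' set21 (eqP E).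
  exists c', a; rewrite (eqP E) Ea Eb -Eb -(eqP E) Ec' set21 (eqP E).
  by rewrite eq_sym.
move: Ec; rewrite -ccE Ec' => E.
by have := set21 u' v; rewrite E !inE (negPf uv') orbF => /eqP.
Qed.

(** With [u] and [c] shared, everything is forced in turn: [v] is the other end of [c], [w] the
    other end of the multiedge at [v], [d] the edge from [u] to [w], and [e] the remaining edge at
    [u]. *)
Lemma block_exit_eq_of_c u v v' w w' a a' b b' c d d' e e' :
  block u v w a b c d e -> block u v' w' a' b' c d' e' -> e = e'.
Proof.
move=> B B'.
have [Ea Eb Ec Ed] := block_ends B; have [Ea' _ Ec' Ed'] := block_ends B'.
have [uv uw vw] := block_neq B; have [uv' uw' vw'] := block_neq B'.
have vE : v' = v.
  have := set22 u v'; rewrite -Ec' Ec !inE => /orP[] /eqP// E.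
  by rewrite E eqxx in uv'.
have wE : w' = w.
  have : v \in ends a' by rewrite Ea' -vE set21.
  have ua' : u \notin ends a' by rewrite Ea' !inE negb_or uv' uw'.
  have a'c : a' != c by apply: contraNneq ua' => ->; rewrite Ec set21.
  have := set22 v' w'; rewrite -Ea' (block_v B) (negPf a'c) orbF.
  move=> wa' /orP[] /eqP E; move: wa'; rewrite E ?Ea ?Eb !inE;
    case/orP=> /eqP// E'; by rewrite E' vE eqxx in vw'.
have dE : d' = d.
  have := set22 u w'; rewrite -Ed' wE; have := set21 u w'; rewrite -Ed'.
  rewrite (block_u B) => /or3P[] /eqP->//.
    by rewrite Ec !inE [_ == u]eq_sym [_ == v]eq_sym (negPf uw) (negPf vw).
  by rewrite (negPf (block_exit_w B)).
have : u \in ends e by rewrite (block_u B) eqxx !orbT.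
case: (B) => _ _ _ _ /=; rewrite !inE negb_or => /and3P[/andP[_ ce] de _].
rewrite (block_u B') dE => /or3P[] /eqP//.
  by move=> E; rewrite E eqxx in ce.
by move=> E; rewrite E eqxx in de.
Qed.

(** Both [c'] and [d'] are among [c], [d], [e], and they are distinct, so one of them is [c] or [d].
    Up to swapping the outer vertices, the two blocks then share this edge as their [c]. *)
Lemma block_exit_eq u v v' w w' a a' b b' c c' d d' e e' :
  block u v w a b c d e -> block u v' w' a' b' c' d' e' -> e = e'.
Proof.
move=> B B'.
have : u \in ends c' by rewrite (block_u B') eqxx.
have : u \in ends d' by rewrite (block_u B') eqxx orbT.
rewrite !(block_u B) => /or3P[] /eqP Ed' /or3P[] /eqP Ec'; subst.
all: try exact: block_exit_eq_of_c B B'.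
all: try exact: block_exit_eq_of_c (block_swap B) B'.
all: try exact: block_exit_eq_of_c (block_swap B) (block_swap B').
all: try exact: block_exit_eq_of_c B (block_swap B').
by case: B' => _ _ _ _ /=; rewrite !inE eqxx.
Qed.

End Block.

(** * The image of the central triangle *)

Lemma ord3_third (i j : 'I_3) : exists k, [/\ k != i, k != j &
  i != j -> forall l, [|| l == i, l == j | l == k]].
Proof.
(* The three indices sum to 3, so the third one is [3 - i - j]; for equal indices the cyclic
   successor serves. *)
exists (inord (if i == j then i.+1 %% 3 else 3 - i - j)).
case: i j => [[|[|[|//]]] ?] [[|[|[|//]]] ?]; rewrite -!val_eqE /= ?inordK //;
  by split=> // _ [[|[|[|]]] ?]; rewrite -?val_eqE /= ?inordK.
Qed.

(* [F i] is the image of the edge of the central triangle of S12 that is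
   opposite to the vertex sent to [Z i]. *)
Section Core.
Context (H : multigraph) (U V W Z : 'I_3 -> vertex H)
  (A B C D E F : 'I_3 -> edge H).
Context (blocks : forall i,
  block (U i) (V i) (W i) (A i) (B i) (C i) (D i) (E i)).
Context (starZ : forall i g,
  (Z i \in ends g) = (g == E i) || [exists j, (j != i) && (g == F j)]).
Context (injF : injective F).

Lemma U_neq_V i j : U i != V j.
Proof.
apply/eqP=> UV; apply: (block_multiedge_u (blocks i)).
by rewrite UV; apply: block_multiedge_v (blocks j).
Qed.

Lemma U_neq_W i j : U i != W j.
Proof.
apply/eqP=> UW; apply: (block_multiedge_u (blocks i)).
by rewrite UW; apply: block_multiedge_w (blocks j).
Qed.

Let inUE i : U i \in ends (E i).
Proof. by rewrite (block_u (blocks i)) eqxx !orbT. Qed.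

Let inZE i : Z i \in ends (E i).
Proof. by rewrite starZ eqxx. Qed.

Let inZF i j : j != i -> Z i \in ends (F j).
Proof.
move=> ji; rewrite starZ; apply/orP; right.
by apply/existsP; exists j; rewrite ji eqxx.
Qed.

Let E_not_multiple i g : g != E i -> ends g <> ends (E i).
Proof.
move=> gE Eg; apply: (block_multiedge_u (blocks i)).
by exists g, (E i); rewrite Eg inUE.
Qed.

(** The edge [E i] has no parallel, because its end [U i] is on no multiedge. Parallel edges at
    [Z i] would thus be [F j] and [F k]; but then [F k] meets [Z k], whose star consists of [E k]
    and the [F l] with [l] other than [k]. *)
Lemma Z_not_on_multiedge i : ~ on_multiedge (Z i).
Proof.
move=> [g [h [gh Zg Egh]]]; have Zh : Z i \in ends h by rewrite -Egh.
move: Zg; rewrite starZ => /orP[/eqP gE|/existsP[j /andP[ji /eqP gF]]].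
  by apply: (@E_not_multiple i h); rewrite -gE 1?eq_sym.
move: Zh; rewrite starZ => /orP[/eqP hE|/existsP[k /andP[ki /eqP hF]]].
  by apply: (@E_not_multiple i g); rewrite -hE.
have jk : j != k by apply: contraNneq gh => jk; rewrite gF hF jk.
have : Z k \in ends h by rewrite -Egh gF inZF.
rewrite starZ => /orP[/eqP hE|/existsP[l /andP[lk /eqP hFl]]].
  by apply: (@E_not_multiple k g); rewrite -hE.
by move: lk; rewrite (injF (etrans (esym hFl) hF)) eqxx.
Qed.

(** [F i] meets [Z j], hence [Z i], where [E i] is the only edge it can be. *)
Let Z_eq_EF i j : i != j -> Z i = Z j -> E i = F i.
Proof.
move=> ij Zij; have := inZF ij; rewrite -Zij starZ.
case/orP=> [/eqP//|/existsP[k /andP[ki /eqP/injF ik]]].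
by rewrite ik eqxx in ki.
Qed.

(** If exactly [Z i] and [Z j] coincided, [F i] and [F j] would both join this vertex to [Z k], a
    multiedge at [Z i]. *)
Lemma Z_injective_or_constant : injective Z \/ forall i j, Z i = Z j.
Proof.
have [/injectiveP|/injectivePn[i [j ij Zij]]] := boolP (injectiveb Z).
  by left.
right; have [k [ki kj ijk]] := ord3_third i j.
suff Zki : Z k = Z i.
  have ZE l : Z l = Z i by case/or3P: (ijk ij l) => /eqP->; rewrite -?Zij.
  by move=> l m; rewrite !ZE.
apply/eqP/negPn/negP=> Zki; apply: (@Z_not_on_multiedge i).
have iF : ends (F i) = [set Z k; Z i].
  apply: ends_eq2 => //; first by rewrite inZF // eq_sym.
  by rewrite -(Z_eq_EF ij Zij) inZE.
have jF : ends (F j) = [set Z k; Z i].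
  by apply: ends_eq2 => //; rewrite inZF // eq_sym.
exists (F i), (F j); rewrite iF jF set22; split=> //.
by apply: contraNneq ij => /injF->.
Qed.

Lemma E_eq_F_of_constant i : (forall i j, Z i = Z j) -> E i = F i.
Proof.
move=> cstZ; have [l [il _ _]] := ord3_third i i.
by apply: (@Z_eq_EF i l); rewrite 1?eq_sym.
Qed.

(* [C i] and [D i] have an end on a multiedge. *)
Let exit_of_simple i g : U i \in ends g ->
  (forall y, y \in ends g -> ~ on_multiedge y) -> g = E i.
Proof.
have [_ _ Ci Di] := block_ends (blocks i).
rewrite (block_u (blocks i)) => /or3P[] /eqP-> // simple; exfalso.
  apply: (simple (V i)); first by rewrite Ci set22.
  exact: block_multiedge_v (blocks i).
apply: (simple (W i)); first by rewrite Di set22.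
exact: block_multiedge_w (blocks i).
Qed.

(** Suppose [Z j = U i]. If [Z] is injective, the two triangle edges at [Z j] have no end on a
    multiedge, so both equal [E i]. If [Z] is constant, every [E k] meets [U i]: it is [E i], or
    else [C i] or [D i], which forces [U k = U i] and again [E k = E i]. Either way [F] is not
    injective. *)
Lemma Z_neq_U i j : Z j != U i.
Proof.
apply/eqP=> ZU; have [injZ|cstZ] := Z_injective_or_constant.
  have [k [kj _ _]] := ord3_third j j; have [l [lj lk _]] := ord3_third j k.
  have FE m n : m != j -> n != j -> n != m -> F m = E i.
    move=> mj nj nm; apply: exit_of_simple; first by rewrite -ZU inZF.
    have -> : ends (F m) = [set Z j; Z n].
      by apply: ends_eq2; rewrite ?inZF ?(inj_eq injZ) 1?eq_sym // eq_sym.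
    by move=> y; rewrite !inE => /orP[] /eqP->; apply: Z_not_on_multiedge.
  have kl : k != l by rewrite eq_sym.
  by case/eqP: kl; apply: injF; rewrite (FE k l) ?(FE l k) // eq_sym.
have EE k : E k = E i.
  have Uik : U i \in ends (E k) by rewrite -ZU (cstZ j k).
  have [_ _ Ci Di] := block_ends (blocks i).
  have Uki : E k = E i \/ U k = U i.
    have := inUE k; move: Uik; rewrite (block_u (blocks i)).
    case/or3P=> /eqP Ek; last by left.
      by rewrite Ek Ci !inE (negPf (U_neq_V _ _)) orbF => /eqP; right.
    by rewrite Ek Di !inE (negPf (U_neq_W _ _)) orbF => /eqP; right.
  case: Uki => // Uki.
  by have := blocks k; rewrite Uki => bk; apply: block_exit_eq bk (blocks i).
have [k [ki _ _]] := ord3_third i i; move/eqP: ki; apply.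
by apply: injF; rewrite -!E_eq_F_of_constant.
Qed.

(** For injective [Z], the only [Z j] among the ends of [E i] is [Z i]; for constant [Z], [E]
    coincides with [F]. *)
Lemma E_injective : injective E.
Proof.
move=> i j Eij; have [injZ|cstZ] := Z_injective_or_constant.
  have : Z j \in ends (E i) by rewrite Eij.
  have -> : ends (E i) = [set U i; Z i].
    by apply: ends_eq2; rewrite // eq_sym Z_neq_U.
  by rewrite !inE (negPf (Z_neq_U _ _)) => /eqP/injZ.
by apply: injF; rewrite -!E_eq_F_of_constant.
Qed.

Lemma U_injective : injective U.
Proof.
move=> i j Uij; apply: E_injective; have := blocks j; rewrite -Uij => bj.
exact: block_exit_eq (blocks i) bj.
Qed.

Lemma V_injective : injective V.
Proof.
move=> i j Vij; apply: U_injective; have := blocks j; rewrite -Vij => bj.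
exact: block_v_inj (blocks i) bj.
Qed.

Lemma W_injective : injective W.
Proof.
move=> i j Wij; apply: U_injective; have := blocks j; rewrite -Wij => bj.
exact: block_v_inj (block_swap (blocks i)) (block_swap bj).
Qed.

Lemma V_neq_W i j : V i != W j.
Proof.
apply/eqP=> VW; have := blocks j; rewrite -VW => bj.
have /U_injective ij := block_v_inj (blocks i) (block_swap bj).
by have [_ _] := block_neq (blocks i); rewrite VW ij eqxx.
Qed.

Lemma Z_neq_V i j : Z i != V j.
Proof.
apply/eqP=> ZV; apply: (@Z_not_on_multiedge i); rewrite ZV.
exact: block_multiedge_v (blocks j).
Qed.

Lemma Z_neq_W i j : Z i != W j.
Proof.
apply/eqP=> ZW; apply: (@Z_not_on_multiedge i); rewrite ZW.
exact: block_multiedge_w (blocks j).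
Qed.

End Core.

(** * Stars of [S12] and [S10] *)

Lemma S12_vertex_eqE :
  ((forall i j, (z12 i == z12 j) = (i == j)) *
   (forall i j, (u12 i == u12 j) = (i == j)) *
   (forall i j, (v12 i == v12 j) = (i == j)) *
   (forall i j, (w12 i == w12 j) = (i == j)))%type.
Proof. by []. Qed.

(** The indices are flipped on the right so that edge equalities yield the same test [i == j] as
    vertex membership, and one case split settles both. *)
Lemma S12_edge_eqE :
  ((forall i j b c, (vw12 i b == vw12 j c) = (j == i) && (b == c)) *
   (forall i j, (uv12 i == uv12 j) = (j == i)) *
   (forall i j, (uw12 i == uw12 j) = (j == i)) *
   (forall i j, (uz12 i == uz12 j) = (j == i)) *
   (forall i j, (zz12 i == zz12 j) = (j == i)))%type.
Proof. by do 4 ?split; move=> i j *; rewrite [j == i]eq_sym. Qed.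

Lemma incident_S12_u i :
  incident_edges S12 (u12 i) = [set uv12 i; uw12 i; uz12 i].
Proof.
by apply/setP=> -[j b|j|j|j|j]; rewrite !inE ?(S12_vertex_eqE, S12_edge_eqE);
  case: (i == j).
Qed.

Lemma incident_S12_v i :
  incident_edges S12 (v12 i) = [set vw12 i true; vw12 i false; uv12 i].
Proof.
by apply/setP=> -[j b|j|j|j|j]; rewrite !inE ?(S12_vertex_eqE, S12_edge_eqE);
  case: (i == j); try case: b.
Qed.

Lemma incident_S12_w i :
  incident_edges S12 (w12 i) = [set vw12 i true; vw12 i false; uw12 i].
Proof.
by apply/setP=> -[j b|j|j|j|j]; rewrite !inE ?(S12_vertex_eqE, S12_edge_eqE);
  case: (i == j); try case: b.
Qed.

Lemma incident_S12_z i : incident_edges S12 (z12 i) =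
  [set g | (g == uz12 i) || [exists j, (j != i) && (g == zz12 (ordS j))]].
Proof.
apply/setP=> g; rewrite !inE; case: g => [j b|j|j|j|j];
  rewrite !inE ?(S12_vertex_eqE, S12_edge_eqE).
1-4: by case: existsP => [[k /andP[]]|_] //; rewrite orbF.
(* The edge [zz12 j] misses exactly the vertex of index [ord_pred j]. *)
have -> : (i == j) || (i == ordS j) = (ord_pred j != i).
  by case: i j => [[|[|[|//]]] ?] [[|[|[|//]]] ?].
apply/idP/existsP=> [ji|[k /andP[ki /eqP[->]]]]; last by rewrite ordSK.
by exists (ord_pred j); rewrite ji ord_predK eqxx.
Qed.

Lemma S10_vertex_eqE :
  ((forall i j, (u10 i == u10 j) = (i == j)) *
   (forall i j, (v10 i == v10 j) = (i == j)) *
   (forall i j, (w10 i == w10 j) = (i == j)))%type.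
Proof. by []. Qed.

Lemma S10_edge_eqE :
  ((forall i j b c, (vw10 i b == vw10 j c) = (j == i) && (b == c)) *
   (forall i j, (uv10 i == uv10 j) = (j == i)) *
   (forall i j, (uw10 i == uw10 j) = (j == i)) *
   (forall i j, (uz10 i == uz10 j) = (j == i)))%type.
Proof. by do 3 ?split; move=> i j *; rewrite [j == i]eq_sym. Qed.

Lemma incident_S10_u i :
  incident_edges S10 (u10 i) = [set uv10 i; uw10 i; uz10 i].
Proof.
by apply/setP=> -[j b|j|j|j]; rewrite !inE ?(S10_vertex_eqE, S10_edge_eqE);
  case: (i == j).
Qed.

Lemma incident_S10_v i :
  incident_edges S10 (v10 i) = [set vw10 i true; vw10 i false; uv10 i].
Proof.
by apply/setP=> -[j b|j|j|j]; rewrite !inE ?(S10_vertex_eqE, S10_edge_eqE);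
  case: (i == j); try case: b.
Qed.

Lemma incident_S10_w i :
  incident_edges S10 (w10 i) = [set vw10 i true; vw10 i false; uw10 i].
Proof.
by apply/setP=> -[j b|j|j|j]; rewrite !inE ?(S10_vertex_eqE, S10_edge_eqE);
  case: (i == j); try case: b.
Qed.

Lemma incident_S10_z : incident_edges S10 z10 = [set uz10 i | i : 'I_3].
Proof.
apply/setP=> -[j b|j|j|j]; rewrite !inE; apply/esym.
1-3: by apply/imsetP=> -[].
exact: imset_f.
Qed.

Theorem corollary3p8 (H : multigraph) (conn_H : connected H)
    (H_colours_S12 : colours H S12) :
  isomorphic H S10 \/ isomorphic H S12.
Proof.
have [f [proper_f /fin_all_exists[X starX]]] := H_colours_S12.
have inj_at (u : S12_vertex) (e e' : S12_edge) :
    u \in S12_ends e -> u \in S12_ends e' -> e != e' -> f e != f e'.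
  move=> ue ue' ee'; apply/eqP; apply: proper_f; rewrite /adjacent_edges ee' /=.
  by apply/set0Pn; exists u; rewrite inE; apply/andP.
have mem_ends u g : (X u \in ends g) = (g \in f @: incident_edges S12 u).
  by rewrite starX inE.
pose blk i := @block H (X (u12 i)) (X (v12 i)) (X (w12 i))
  (f (vw12 i true)) (f (vw12 i false)) (f (uv12 i)) (f (uw12 i)) (f (uz12 i)).
have blocks i : blk i.
  split=> [g|g|g||].
  - by rewrite mem_ends incident_S12_u !imsetU !imset_set1 !inE orbA.
  - by rewrite mem_ends incident_S12_v !imsetU !imset_set1 !inE orbA.
  - by rewrite mem_ends incident_S12_w !imsetU !imset_set1 !inE orbA.
  - rewrite /= !inE !negb_or; do ![apply/andP; split] => //;
    solve [apply: (inj_at (v12 i)); rewrite ?inE ?eqxx ?orbT //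
          | apply: (inj_at (w12 i)); rewrite ?inE ?eqxx ?orbT //
          | apply: (inj_at (u12 i)); rewrite ?inE ?eqxx ?orbT //
          | apply: (inj_at (v12 i)); rewrite ?inE ?eqxx ?orbT //
            S12_edge_eqE eqxx //].
  - rewrite /= !inE !negb_or; do ![apply/andP; split] => //;
    by apply: (inj_at (u12 i)); rewrite ?inE ?eqxx ?orbT.
(* The shift by [ordS] selects the triangle edge opposite to [z12 i]. *)
pose F i := f (zz12 (ordS i)).
have starZ i g : (X (z12 i) \in ends g) =
    (g == f (uz12 i)) || [exists j, (j != i) && (g == F j)].
  rewrite mem_ends incident_S12_z; apply/imsetP/orP.
    case=> e; rewrite inE => /orP[/eqP->|/existsP[j /andP[ji /eqP->]]] ->.
      by left.
    by right; apply/existsP; exists j; rewrite ji /=.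
  case=> [/eqP->|/existsP[j /andP[ji /eqP->]]].
    by exists (uz12 i); rewrite // inE eqxx.
  exists (zz12 (ordS j)); rewrite // inE; apply/orP; right.
  by apply/existsP; exists j; rewrite ji /=.
have zF i j : j != i -> z12 i \in S12_ends (zz12 (ordS j)).
  by case: i j => [[|[|[|//]]] ?] [[|[|[|//]]] ?]; rewrite !inE !S12_vertex_eqE.
have injF : injective F.
  move=> i j; have [//|ij Fij] := eqVneq i j.
  (* The triangle edges opposite to [z12 i] and [z12 j] meet at [z12 k], so properness separates
     their images. *)
  have [k [ki kj _]] := ord3_third i j.
  suff /eqP : F i != F j by [].
  have zz_ij : zz12 (ordS i) != zz12 (ordS j).
    by rewrite S12_edge_eqE (inj_eq (can_inj (@ordSK 3))) eq_sym.
  by apply: inj_at zz_ij; apply: (zF k); rewrite eq_sym.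
have parallel_f (e e' : S12_edge) :
    S12_ends e = S12_ends e' -> f e = f e' -> e = e'.
  move=> Ee fee; apply/eqP/negPn/negP => ee'.
  have /card_gt0P[u ue] : 0 < #|S12_ends e| by rewrite S12_card_ends.
  by have := inj_at u e e' ue; rewrite -Ee ue ee' fee eqxx => /(_ isT isT).
have injU := U_injective blocks starZ injF.
have injV := V_injective blocks starZ injF.
have injW := W_injective blocks starZ injF.
have ZU := Z_neq_U blocks starZ injF.
have ZV := Z_neq_V blocks starZ injF.
have ZW := Z_neq_W blocks starZ injF.
have UV := U_neq_V blocks.
have UW := U_neq_W blocks.
have VW := V_neq_W blocks starZ injF.
have neqE := (fun i j => negPf (ZU i j), fun i j => negPf (ZV i j),
  fun i j => negPf (ZW i j), fun i j => negPf (UV i j),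
  fun i j => negPf (UW i j), fun i j => negPf (VW i j)).
have [injZ|cstZ] := Z_injective_or_constant blocks starZ injF.
  right; apply: (isomorphic_of_injective conn_H _ _ starX parallel_f).
    by apply/card_gt0P; exists (z12 ord0).
  move=> [i|i|i|i] [j|j|j|j] Xij; solve
    [ by rewrite (injZ _ _ Xij) | by rewrite (injU _ _ Xij)
    | by rewrite (injV _ _ Xij) | by rewrite (injW _ _ Xij)
    | by move/eqP: Xij; rewrite neqE
    | by move/esym/eqP: Xij; rewrite neqE ].
left.
(* All [z12 i] have the same image here, so [ord0] is an arbitrary choice; [f10] is [f] on the edges
   outside the triangle. *)
pose X10 (u : S10_vertex) := match u with
  | z10 => X (z12 ord0) | u10 i => X (u12 i) | v10 i => X (v12 i)
  | w10 i => X (w12 i) end.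
pose f10 (e : S10_edge) := match e with
  | vw10 i b => f (vw12 i b) | uv10 i => f (uv12 i) | uw10 i => f (uw12 i)
  | uz10 i => f (uz12 i) end.
apply: (@isomorphic_of_injective H S10 f10 X10 conn_H).
- by apply/card_gt0P; exists z10.
- move=> [|i|i|i] [|j|j|j] //= Xij; solve
    [ by rewrite (injU _ _ Xij) | by rewrite (injV _ _ Xij)
    | by rewrite (injW _ _ Xij)
    | by move/eqP: Xij; rewrite neqE
    | by move/esym/eqP: Xij; rewrite neqE ].
- case=> [|i|i|i] /=.
  + rewrite incident_S10_z; apply/setP=> g; rewrite inE starZ.
    have Fi i : F i = f (uz12 i) by rewrite (E_eq_F_of_constant starZ injF).
    apply/imsetP/orP=> [[_ /imsetP[j _ ->] ->]|
      [/eqP->|/existsP[j /andP[_ /eqP->]]]].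
    * have [->|j0] := eqVneq j ord0; first by left.
      by right; apply/existsP; exists j; rewrite j0 Fi /=.
    * by exists (uz10 ord0); rewrite ?imset_f.
    * by exists (uz10 j); rewrite ?imset_f ?Fi.
  + by rewrite incident_S10_u -starX incident_S12_u !imsetU !imset_set1.
  + by rewrite incident_S10_v -starX incident_S12_v !imsetU !imset_set1.
  + by rewrite incident_S10_w -starX incident_S12_w !imsetU !imset_set1.
(* Comparing the ends at these four vertices leaves only edges of one kind and one index; the two
   parallel edges are then separated as in [S12]. *)
move=> [i b|i|i|i] [j c|j|j|j] /setP Eends /= fij;
  move: (Eends (u10 i)) (Eends (v10 i)) (Eends (w10 i)) (Eends z10);
  rewrite !inE !S10_vertex_eqE ?eqxx //=.
all: case: (i =P j) => // ij; subst => //.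
by have [->] := parallel_f (vw12 j b) (vw12 j c) erefl fij.
Qed.
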